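(* Fix an integer $k\geq 3$ and let $A_n$, $\bar A_n$ ($n\geq 1$) be the antiregular $k$-hypergraphs defined in the context. Then $$I(A_i;x)=(1+x)^i\quad\text{for }1\leq i\leq k-1,$$ and for every integer $n\geq k-1$, $$I(\bar A_{n+1};x)=(1+x)\,I(A_n;x),\qquad I(A_{n+1};x)=I(\bar A_n;x)+\sum_{i=1}^{k-1}\binom{n}{i-1}x^i .$$
   Context: All hypergraphs are $k$-uniform: every hyperedge is a set of exactly $k$ vertices. For a binary string $b=b_1b_2\cdots b_n$, let $H(b)$ be the $k$-uniform hypergraph on vertex set $\{1,\dots,n\}$ obtained by adding the vertices $1,2,\dots,n$ in this order, where vertex $j$ is added as an isolated vertex (no new hyperedges) if $b_j=0$, and as a dominating vertex if $b_j=1$, meaning that every set $\{j\}\cup S$ with $S$ a $(k-1)$-element subset of $\{1,\dots,j-1\}$ is added as a hyperedge. Equivalently, a $k$-subset of $\{1,\dots,n\}$ is a hyperedge of $H(b)$ iff its largest element $j$ satisfies $b_j=1$. Antiregular $k$-hypergraphs: for $1\le n\leq k-1$, $A_n=\bar A_n$ is the hypergraph with $n$ vertices and no hyperedges. For $n\geq k$, $A_n=H(b)$ where $b$ has length $n$, $b_1=\dots=b_{k-1}=0$, the bits $b_k,b_{k+1},\dots,b_n$ alternate ($b_{j+1}\neq b_j$ for $k\le j<n$), and $b_n=1$; $\bar A_n$ is defined in the same way but with $b_n=0$. A vertex subset $W$ of a hypergraph $H$ is independent if it contains no hyperedge of $H$; the independence polynomial is $I(H;x)=\sum_{W\text{ independent}}x^{|W|}$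 (the empty set included). *)

(* Defs.v *)
From mathcomp Require Import all_boot all_order all_algebra.
From mathcomp Require Import zify.

Set Implicit Arguments.
Unset Strict Implicit.
Unset Printing Implicit Defensive.

Import GRing.Theory.

(* Vertices are 0-indexed: the vertex j of {1, .., n} is the ordinal of value
   j - 1, and the bit b_j of a string b is [tnth b] at that ordinal.
   A hypergraph is given by its set of hyperedges. *)

Section Hypergraphs.
Variable k : nat.

Definition dominating_edges n (j : 'I_n) : {set {set 'I_n}} :=
  [set j |: S | S : {set 'I_n}
              & (S \subset [set i : 'I_n | i < j]) && (#|S| == k.-1)].

Definition string_hypergraph n (b : n.-tuple bool) : {set {set 'I_n}} :=
  \bigcup_(j : 'I_n | tnth b j) dominating_edges j.

Lemma string_hypergraphP n (b : n.-tuple bool) (e : {set 'I_n}) : 0 < k ->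
  reflect (#|e| = k /\
           exists2 j : 'I_n, tnth b j & j \in e /\ {in e, forall i : 'I_n, i <= j})
          (e \in string_hypergraph b).
Proof.
move=> k_gt0; apply: (iffP bigcupP) => [[j bj]|[ek [j bj [je le_e]]]].
  case/imsetP=> S; rewrite inE => /andP[/subsetP SS /eqP Sk] ->.
  have jS : j \notin S by apply/negP=> /SS; rewrite inE ltnn.
  split; first by rewrite cardsU1 jS Sk add1n prednK.
  exists j => //; split=> [|i]; first by rewrite setU11.
  by rewrite in_setU1 => /predU1P[->//|/SS]; rewrite inE => /ltnW.
exists j => //; apply/imsetP; exists (e :\ j); last by rewrite setD1K.
rewrite inE; apply/andP; split.
  apply/subsetP=> i; rewrite !inE => /andP[ij ie].
  by rewrite ltn_neqAle le_e // andbT.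
by move: (cardsD1 j e); rewrite ek je add1n => ->.
Qed.

(* The string of length n with b_j = 0 for j < k, alternating from position k
   on, and last bit c. *)
Definition antireg_string n (c : bool) : n.-tuple bool :=
  [tuple (k <= j.+1) && (odd (n - j.+1) (+) c) | j < n].

Lemma antireg_stringP n (c : bool) (b : n.-tuple bool) : k <= n -> 0 < n ->
  [/\ forall j : 'I_n, j.+1 < k -> tnth b j = false,
      forall i j : 'I_n, k <= i.+1 -> j = i.+1 :> nat -> tnth b j != tnth b i
    & forall j : 'I_n, j.+1 = n -> tnth b j = c]
  <-> b = antireg_string n c.
Proof.
move=> le_kn n_gt0; split=> [[b0 balt bn]|->]; last first.
  split=> [j jk|i j ki ji|j jn]; rewrite !tnth_mktuple.
  - by rewrite leqNgt jk.
  - have jn := ltn_ord j; rewrite ji ki (leq_trans ki) //=.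
    have -> : n - i.+1 = (n - i.+2).+1 by lia.
    by rewrite /=; case: (odd _) c => [] [].
  - by rewrite jn le_kn subnn.
apply: eq_from_tnth => j; rewrite tnth_mktuple.
have [kj|jk] := leqP k j.+1; last by rewrite b0.
have [m Em] : exists m, n - j.+1 = m by exists (n - j.+1).
rewrite Em /=; elim: m j kj Em => [|m IHm] j kj Em.
  by rewrite bn //; have := ltn_ord j; lia.
have jn : j.+1 < n by lia.
have := balt j (Ordinal jn) kj erefl.
rewrite IHm /=; [|lia|lia].
by case: (tnth b j); case: (odd m); case: (c).
Qed.

Definition antireg n : {set {set 'I_n}} :=
  if n < k then set0 else string_hypergraph (antireg_string n true).

Definition antireg_bar n : {set {set 'I_n}} :=
  if n < k then set0 else string_hypergraph (antireg_string n false).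

End Hypergraphs.

Definition independent (T : finType) (H : {set {set T}}) (W : {set T}) : bool :=
  [forall e in H, ~~ (e \subset W)].

Definition indep_poly (T : finType) (H : {set {set T}}) : {poly int} :=
  (\sum_(W : {set T} | independent H W) 'X^#|W|)%R.

(* Main.v *)
Require Import Defs.
From mathcomp Require Import all_boot all_order all_algebra.

Import GRing.Theory.
Local Open Scope ring_scope.

(** A set [W] is independent in [H(b)] iff every [j] in [W] with [b_j = 1] has
    fewer than [k - 1] predecessors in [W]. Hence, after appending a vertex [v]
    to [H(b)], the sets avoiding [v] are independent iff they were before; if
    [v] is isolated, the same holds for the sets containing [v], while if [v] is
    dominating, a set [{v} U V] is independent iff [#|V| < k - 1]. Removing the
    last vertex from an antiregular string complements its last bit. *)

(** A vertex [j] with bit 1 forms a hyperedge with any [k.-1] of its predecessors, and every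
    hyperedge arises this way from its largest vertex. *)
Lemma independent_stringP (k n : nat) (b : n.-tuple bool) (W : {set 'I_n}) :
  reflect (forall j : 'I_n, tnth b j -> j \in W ->
             (#|W :&: [set i : 'I_n | (i < j)%N]| < k.-1)%N)
          (independent (string_hypergraph k b) W).
Proof.
apply: (iffP forall_inP) => [indW j bj jW|small e /bigcupP[j bj]].
  (* With at least [k.-1] predecessors in [W], choose exactly [k.-1] of them, listed in [s], to
     build a hyperedge inside [W]. *)
  rewrite ltnNge; apply/card_geqP => -[s [s_uniq s_size sW]].
  have sub_s : [set i in s] \subset W :&: [set i : 'I_n | (i < j)%N].
    by apply/subsetP => i; rewrite inE => /sW.
  have /indW/negP[] : j |: [set i in s] \in string_hypergraph k b.
    apply/bigcupP; exists j => //; apply/imsetP; exists [set i in s] => //.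
    rewrite inE (subset_trans sub_s (subsetIr _ _)) /=.
    by rewrite cardsE (card_uniqP s_uniq) s_size.
  by rewrite subUset sub1set jW (subset_trans sub_s (subsetIl _ _)).
case/imsetP => S; rewrite inE => /andP[Sj /eqP S_card] ->.
apply/negP; rewrite subUset sub1set => /andP[jW SW].
have := small j bj jW; rewrite ltnNge -S_card subset_leq_card //.
by rewrite subsetI SW Sj.
Qed.

Lemma ord_max_notin_lift (n : nat) (V : {set 'I_n}) :
  ord_max \notin [set lift ord_max i | i in V].
Proof. by apply/imsetP => -[i _] /eqP; rewrite (negPf (neq_lift _ _)). Qed.

Lemma preim_lift_ord_max (n : nat) (V : {set 'I_n}) :
  lift ord_max @^-1: [set lift ord_max i | i in V] = V.
Proof. by apply/setP => i; rewrite inE (mem_imset _ _ lift_inj). Qed.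

Lemma preim_lift_ord_maxU (n : nat) (V : {set 'I_n}) :
  lift ord_max @^-1: (ord_max |: [set lift ord_max i | i in V]) = V.
Proof.
apply/setP => i; rewrite !inE (mem_imset _ _ lift_inj) eq_sym.
by rewrite (negPf (neq_lift _ _)).
Qed.

Lemma imset_preim_lift_ord_max (n : nat) (W : {set 'I_n.+1}) :
  [set lift ord_max i | i in lift ord_max @^-1: W] = W :\ ord_max.
Proof.
apply/setP => j; rewrite !inE; case: (unliftP ord_max j) => [i ->|->].
  by rewrite (mem_imset _ _ lift_inj) inE eq_sym neq_lift.
by rewrite eqxx (negPf (ord_max_notin_lift _ _)).
Qed.

Lemma big_set_ord_recr (R : nmodType) (n : nat) (P : pred {set 'I_n.+1})
    (F : {set 'I_n.+1} -> R) :
  \sum_(W | P W) F W =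
    \sum_(V : {set 'I_n} | P [set lift ord_max i | i in V])
       F [set lift ord_max i | i in V]
    + \sum_(V : {set 'I_n} | P (ord_max |: [set lift ord_max i | i in V]))
       F (ord_max |: [set lift ord_max i | i in V]).
Proof.
rewrite (bigID (fun W : {set 'I_n.+1} => ord_max \in W)) /= addrC.
congr (_ + _).
(* In both halves the inverse reindexing is the preimage under [lift ord_max], which forgets the
   last vertex. *)
- rewrite (reindex_onto (fun V : {set 'I_n} => [set lift ord_max i | i in V])
    (fun W => lift ord_max @^-1: W)) /=.
    by apply: eq_bigl => V; rewrite ord_max_notin_lift preim_lift_ord_max
      eqxx !andbT.
  move=> W /andP[_ WN]; rewrite imset_preim_lift_ord_max.
  by apply/setDidPl; rewrite disjoint_sym disjoints1.
- rewrite (reindex_onto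
    (fun V : {set 'I_n} => ord_max |: [set lift ord_max i | i in V])
    (fun W => lift ord_max @^-1: W)) /=.
    by apply: eq_bigl => V; rewrite setU11 preim_lift_ord_maxU eqxx !andbT.
  by move=> W /andP[_ WN]; rewrite imset_preim_lift_ord_max setD1K.
Qed.

Lemma card_lift_ord_max (n : nat) (V : {set 'I_n}) :
  #|[set lift ord_max i | i in V]| = #|V|.
Proof. exact: card_imset lift_inj. Qed.

Lemma card_lift_ord_maxU (n : nat) (V : {set 'I_n}) :
  #|ord_max |: [set lift ord_max i | i in V]| = #|V|.+1.
Proof. by rewrite cardsU1 ord_max_notin_lift card_lift_ord_max. Qed.

Lemma card_preds_lift (n : nat) (W : {set 'I_n.+1}) (j : 'I_n) :
  #|W :&: [set i : 'I_n.+1 | (i < lift ord_max j)%N]|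
  = #|(lift ord_max @^-1: W) :&: [set i : 'I_n | (i < j)%N]|.
Proof.
rewrite -[RHS]card_lift_ord_max; apply: eq_card => i.
case: (unliftP ord_max i) => [i' ->|->].
  by rewrite (mem_imset _ _ lift_inj) !inE !lift_max.
rewrite (negPf (ord_max_notin_lift _ _)) !inE lift_max ltnNge.
by rewrite ltnW ?andbF.
Qed.

Lemma card_preds_ord_max (n : nat) (W : {set 'I_n.+1}) :
  #|W :&: [set i : 'I_n.+1 | (i < @ord_max n)%N]| = #|lift ord_max @^-1: W|.
Proof.
rewrite -[RHS]card_lift_ord_max imset_preim_lift_ord_max.
apply: eq_card => i.
rewrite !inE andbC; congr (_ && _).
by rewrite ltn_neqAle -ltnS ltn_ord andbT.
Qed.

Section AppendVertex.

Variables (k n : nat) (b : n.-tuple bool) (b' : n.+1.-tuple bool).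
Hypothesis b'_lift : forall i : 'I_n, tnth b' (lift ord_max i) = tnth b i.

(** The new vertex is a predecessor of no old one, so old conditions are unchanged; its own
    predecessors in [W] are all the old vertices of [W]. *)
Lemma independent_append (W : {set 'I_n.+1}) :
  independent (string_hypergraph k b') W =
    independent (string_hypergraph k b) (lift ord_max @^-1: W)
    && (tnth b' ord_max && (ord_max \in W) ==>
          (#|lift ord_max @^-1: W| < k.-1)%N).
Proof.
apply/independent_stringP/andP => [small|[/independent_stringP small big]].
  split; last first.
    by apply/implyP => /andP[b1 W1]; rewrite -card_preds_ord_max small.
  apply/independent_stringP => j bj; rewrite inE => jW.
  by rewrite -card_preds_lift small ?b'_lift.
move=> j; case: (unliftP ord_max j) => [i ->|->] b1 W1.
  by rewrite card_preds_lift small ?inE // -b'_lift.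
by rewrite card_preds_ord_max (implyP big) // b1.
Qed.

Lemma indep_poly_isolated : tnth b' ord_max = false ->
  indep_poly (string_hypergraph k b') =
    (1 + 'X) * indep_poly (string_hypergraph k b).
Proof.
move=> b'0; rewrite /indep_poly big_set_ord_recr mulrDl mul1r mulr_sumr.
congr (_ + _).
  apply: eq_big => V; last by rewrite card_lift_ord_max.
  by rewrite independent_append preim_lift_ord_max b'0 andbT.
apply: eq_big => V; last by rewrite card_lift_ord_maxU exprS.
by rewrite independent_append preim_lift_ord_maxU b'0 andbT.
Qed.

Lemma indep_poly_dominating : tnth b' ord_max ->
  indep_poly (string_hypergraph k b') =
    indep_poly (string_hypergraph k b)
    + \sum_(V : {set 'I_n} | (#|V| < k.-1)%N) 'X^(#|V|.+1).
Proof.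
move=> b'1; rewrite /indep_poly big_set_ord_recr; congr (_ + _).
  apply: eq_big => V; last by rewrite card_lift_ord_max.
  rewrite independent_append preim_lift_ord_max.
  by rewrite (negPf (ord_max_notin_lift _ _)) andbF andbT.
apply: eq_big => V; last by rewrite card_lift_ord_maxU.
rewrite independent_append preim_lift_ord_maxU b'1 setU11 /=.
(* The size bound already forces [V] to be independent in the old hypergraph: no vertex of [V] can
   have [k.-1] predecessors in [V]. *)
case: ltnP => V_card; rewrite ?andbF // andbT.
apply/independent_stringP => j _ _.
exact: leq_ltn_trans (subset_leq_card (subsetIl _ _)) V_card.
Qed.

End AppendVertex.

Lemma sum_by_card (R : nmodType) (T : finType) (m : nat) (F : nat -> R) :
  \sum_(V : {set T} | (#|V| < m)%N) F #|V| = \sum_(i < m) F i *+ 'C(#|T|, i).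
Proof.
transitivity (\sum_(i < m) \sum_(V : {set T} | #|V| == i) F #|V|).
  rewrite (exchange_big_dep (fun V : {set T} => #|V| < m)%N) /=; last first.
    by move=> i V _ /eqP->.
  apply: eq_bigr => V V_card.
  by rewrite (big_pred1 (Ordinal V_card)) // => i; rewrite eq_sym.
apply: eq_bigr => i _; rewrite (eq_bigr (fun=> F i)); last by move=> V /eqP->.
by rewrite sumr_const -card_draws cardsE.
Qed.

Lemma indep_poly_set0 (T : finType) :
  indep_poly (set0 : {set {set T}}) = (1 + 'X) ^+ #|T|.
Proof.
rewrite exprDn /indep_poly.
under [RHS]eq_bigr do rewrite expr1n mul1r.
(* The binomial expansion is the sum by cardinality with bound [#|T|.+1], which every subset
   satisfies. *)
rewrite -(sum_by_card _ T _ (fun i => 'X^i)); apply: eq_bigl => V.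
rewrite ltnS max_card; apply/forall_inP => e; by rewrite inE.
Qed.

(** The guard [k <= j.+1] fails at every position, so all bits are 0. This gives the antiregular
    hypergraphs one expression for all lengths, covering the boundary case n = k - 1 of the
    recurrences. *)
Lemma string_hypergraph_short (k n : nat) (c : bool) : (n < k)%N ->
  string_hypergraph k (antireg_string k n c) = set0.
Proof.
move=> n_lt_k; apply: big1 => j; rewrite tnth_mktuple => /andP[k_le_j _].
by have := leq_ltn_trans (leq_trans k_le_j (ltn_ord j)) n_lt_k; rewrite ltnn.
Qed.

Lemma antiregE (k n : nat) :
  antireg k n = string_hypergraph k (antireg_string k n true).
Proof. by rewrite /antireg; case: ifP => // /string_hypergraph_short->. Qed.

Lemma antireg_barE (k n : nat) :
  antireg_bar k n = string_hypergraph k (antireg_string k n false).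
Proof. by rewrite /antireg_bar; case: ifP => // /string_hypergraph_short->. Qed.

(** Bits depend on the parity of the distance to the end; one extra position flips that parity, and
    negating [c] compensates. *)
Lemma antireg_string_lift (k n : nat) (c : bool) (i : 'I_n) :
  tnth (antireg_string k n.+1 c) (lift ord_max i)
  = tnth (antireg_string k n (~~ c)) i.
Proof.
rewrite !tnth_mktuple lift_max subSn ?ltn_ord //=.
by rewrite addNb addbN.
Qed.

Lemma antireg_string_ord_max (k n : nat) (c : bool) :
  tnth (antireg_string k n.+1 c) ord_max = (k <= n.+1)%N && c.
Proof. by rewrite tnth_mktuple subnn. Qed.

Theorem theorem2p2 (k : nat) (hk : (3 <= k)%N) :
  (forall i : nat, (1 <= i <= k - 1)%N ->
     indep_poly (antireg k i) = (1 + 'X) ^+ i) /\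
  (forall n : nat, (k - 1 <= n)%N ->
     indep_poly (antireg_bar k n.+1) = (1 + 'X) * indep_poly (antireg k n) /\
     indep_poly (antireg k n.+1) =
       indep_poly (antireg_bar k n)
       + \sum_(1 <= i < k) 'C(n, i - 1)%:R * 'X^i).
Proof.
(* From here on [k] denotes the original uniformity minus 1. *)
case: k hk => // k _; rewrite subn1 /=; split=> [i /andP[_ i_le_k]|n k_le_n].
  by rewrite /antireg ltnS i_le_k indep_poly_set0 card_ord.
rewrite antireg_barE !antiregE antireg_barE; split.
  apply: indep_poly_isolated; last by rewrite antireg_string_ord_max andbF.
  exact: antireg_string_lift.
(* The bound on [n] is what puts the last vertex beyond the initial zeros, so that its bit is 1. *)
rewrite (indep_poly_dominating _ _ _ _ (antireg_string_lift _ _ _)); last first.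
  by rewrite antireg_string_ord_max ltnS k_le_n.
congr (_ + _).
(* An old set of size [i] contributes degree [i.+1] because of the new vertex, hence the index
   shift. *)
rewrite (sum_by_card _ _ _ (fun i => 'X^(i.+1))) card_ord big_add1 /= big_mkord.
by apply: eq_bigr => i _; rewrite subn1 mulr_natl.
Qed.
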